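(* Let $N,\omega\in\mathbb{N}$, $\tau\in\mathbb{N}_0$, let $r\le-\tau$ be an integer, and for each $i\in\{1,\ldots,N\}$ let $c_i:\mathbb{N}_0\to(-1,1)$ and $h_i:\mathbb{N}_0\times X^N\to\mathbb{R}$ be functions. Consider the difference equation $$x_i(m+1)=c_i(m)\,x_i(m-\tau)+h_i(m,\overline{x}_m),\qquad m\in\mathbb{N}_0,\ i\in\{1,\ldots,N\}.\qquad (E)$$ Assume: (i) $c_i(m+\omega)=c_i(m)$ for all $i\in\{1,\ldots,N\}$ and $m\in\mathbb{N}_0$; (ii) $h_i(m+\omega,\overline\alpha)=h_i(m,\overline\alpha)$ for all $i\in\{1,\ldots,N\}$, $m\in\mathbb{N}_0$ and $\overline\alpha\in X^N$; (iii) for each $i\in\{1,\ldots,N\}$ there is a function $H_i:\mathbb{N}_0\to(0,+\infty)$ such that $|h_i(m,\overline\alpha)-h_i(m,\overline\beta)|\le H_i(m)\|\overline\alpha-\overline\beta\|$ for all $\overline\alpha,\overline\beta\in X^N$, $m\in\mathbb{N}_0$; (iv) there is $c\in(0,1)$ such that $|c_i(m)|\le c$ for all $i\in\{1,\ldots,N\}$ and $m\in\mathbb{N}_0$, and $$\lambda:=\max_{i=1,\ldots,N}\ \max_{s=0,\ldots,\tau}\left[\sup_{n\in\mathbb{N}}\sum_{l=0}^{n-1}\left(\prod_{k=l+1}^{n-1}|c_i(k(\tau+1)+\tau-s)|\right)H_i(l(\tau+1)+\tau-s)\,c^{\,l+\frac{r-s-1}{\tau+1}-n+1}\right]<1.$$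 Then there is an $\omega$-periodic solution $\overline{x}^*$ of (E) such that, for every $\overline\alpha\in X^N$, $$\|\overline{x}_m(\cdot,\overline\alpha)-\overline{x}^*_m\|\le\frac{c^{\frac{r}{\tau+1}-1}}{1-\lambda}\left(c^{\frac{1}{\tau+1}}\right)^m\|\overline\alpha-\overline{x}^*_0\|\qquad\text{for all }m\in\mathbb{N}.$$
   Context: $\mathbb{N}=\{1,2,\ldots\}$, $\mathbb{N}_0=\mathbb{N}\cup\{0\}$. For $I\subseteq\mathbb{R}$, $I_{\mathbb{Z}}=I\cap\mathbb{Z}$. $X$ is the space of functions $\alpha:[r,0]_{\mathbb{Z}}\to\mathbb{R}$ with norm $\|\alpha\|=\max_{j=r,\ldots,0}|\alpha(j)|$. $X^N$ carries the norm $\|\overline\alpha\|=\max_{i=1,\ldots,N}\|\alpha_i\|$ for $\overline\alpha=(\alpha_1,\ldots,\alpha_N)$. For $\overline{x}=(x_1,\ldots,x_N):[r,+\infty)_{\mathbb{Z}}\to\mathbb{R}^N$ and $m\in\mathbb{N}_0$, $\overline{x}_m\in X^N$ is defined by $\overline{x}_m(j)=\overline{x}(m+j)$, $j=r,\ldots,0$. For $\overline\alpha\in X^N$, $\overline{x}(\cdot,\overline\alpha):[r,+\infty)_{\mathbb{Z}}\to\mathbb{R}^N$ is the unique solution of the equation with initial condition $\overline{x}_0=\overline\alpha$, and $\overline{x}_m(\cdot,\overline\alpha)$ is its segment at time $m$. A product with no factors equals $1$. An $\omega$-periodic solution is a solution $\overline{x}^*:[r,+\infty)_{\mathbb{Z}}\to\mathbb{R}^N$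 with $\overline{x}^*(m+\omega)=\overline{x}^*(m)$ for all integers $m\ge r$. *)

(* Defs.v *)
(* MathComp / MathComp-Analysis *)
From mathcomp Require Import all_boot all_order all_algebra.
From mathcomp Require Import ring lra.
From mathcomp Require Import all_classical all_reals all_analysis.
Import Order.TTheory GRing.Theory Num.Theory.
Import numFieldNormedType.Exports.

Set Implicit Arguments.
Unset Strict Implicit.
Unset Printing Implicit Defensive.

Local Open Scope classical_set_scope.
Local Open Scope ring_scope.

(* The space X^N, where X is the space of functions [r, 0]_Z -> R with r <= 0:
   the entry [a i j] is the value of alpha_i at time r + j, j = 0, ..., -r.
   The matrix norm [`|a|] of MathComp-Analysis is the maximum of the absolute
   values of the entries, that is max_i ||alpha_i||. *)
Notation history R N r := ('M[R]_(N, (absz r).+1)).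

(* A function [r, +oo)_Z -> R^N is represented by a function on [int]; its
   values at times < r are never used (in the equation, because r <= - tau). *)
Definition segment (R : realType) (N : nat) (r : int) (x : int -> 'rV[R]_N)
    (m : nat) : history R N r :=
  \matrix_(i, j) x (m%:Z + (r + j%:Z)) 0 i.

Definition is_solution (R : realType) (N : nat) (r : int) (tau : nat)
    (c_ : 'I_N -> nat -> R) (h : 'I_N -> nat -> history R N r -> R)
    (x : int -> 'rV[R]_N) : Prop :=
  forall (m : nat) (i : 'I_N),
    x (m%:Z + 1) 0 i = c_ i m * x (m%:Z - tau%:Z) 0 i + h i m (segment r x m).

Definition is_periodic (R : realType) (N : nat) (r : int) (omega : nat)
    (x : int -> 'rV[R]_N) : Prop :=
  forall m : int, r <= m -> x (m + omega%:Z) = x m.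

(* The sum inside the supremum.  As s <= tau, the truncated subtraction
   [tau - s] is the usual one. *)
Definition weighted_sum (R : realType) (N : nat) (r : int) (tau : nat)
    (c_ H : 'I_N -> nat -> R) (c : R) (i : 'I_N) (s : 'I_tau.+1)
    (n : nat) : R :=
  \sum_(0 <= l < n)
    (\prod_(l.+1 <= k < n) `|c_ i (k * tau.+1 + (tau - s))%N|)
    * H i (l * tau.+1 + (tau - s))%N
    * c `^ (l%:R + (r%:~R - s%:R - 1) / tau.+1%:R - n%:R + 1).

(* The supremum is taken in the extended reals, so that [lambda < 1] includes
   the boundedness of the sums. *)
Definition lambda (R : realType) (N : nat) (r : int) (tau : nat)
    (c_ H : 'I_N -> nat -> R) (c : R) : \bar R :=
  \big[maxe/-oo%E]_(i < N) \big[maxe/-oo%E]_(s < tau.+1)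
    ereal_sup [set (weighted_sum r c_ H c i s n)%:E
              | n in [set n : nat | (0 < n)%N]].

(* For every initial condition the equation has a solution, and that solution
   is unique on [r, +oo)_Z. *)
Section WellPosed.
Variables (R : realType) (N : nat) (r : int) (tau : nat).
Variables (c_ : 'I_N -> nat -> R) (h : 'I_N -> nat -> history R N r -> R).
Hypothesis r_tau : r <= - tau%:Z.

Let r0 : r <= 0. Proof. by rewrite (le_trans r_tau)// oppr_le0. Qed.

Let rE : r = - (absz r)%:Z.
Proof. by rewrite -[RHS]opprK opprK abszE ler0_norm// opprK. Qed.

Lemma solution_unique (x y : int -> 'rV[R]_N) :
  is_solution tau c_ h x -> is_solution tau c_ h y ->
  segment r x 0 = segment r y 0 -> forall t : int, r <= t -> x t = y t.
Proof.
move=> xs ys xy0.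
suff H (n : nat) (t : int) : r <= t -> t <= n%:Z -> x t = y t.
  move=> t rt; apply: (H (absz t)) => //.
  by rewrite abszE ler_norm.
elim: n t => [|n IH] t rt tn.
  have lt : (absz (t - r) < (absz r).+1)%N.
    rewrite ltnS -lez_nat !abszE (ler0_norm r0) ger0_norm ?subr_ge0//.
    by rewrite -[leRHS]add0r lerD2r.
  apply/rowP => i; have /matrixP/(_ i (Ordinal lt)) := xy0.
  rewrite !mxE /= abszE ger0_norm ?subr_ge0//.
  by rewrite add0r addrCA subrr addr0.
have [tn'|nt] := leP t n%:Z; first exact: IH.
have -> : t = n%:Z + 1.
  by apply/eqP; rewrite eq_le lezD1 nt andbT -[_ + 1]/(n%:Z + 1%:Z) -PoszD addn1.
apply/rowP => i; rewrite xs ys.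
rewrite (IH (n%:Z - tau%:Z)); last 2 first.
- by rewrite (le_trans r_tau)// lerDr.
- by rewrite gerDl oppr_le0.
congr (_ + h i n _); apply/matrixP => a b; rewrite !mxE.
rewrite IH//.
- by rewrite addrCA lerDl addr_ge0.
- by rewrite gerDl -lerBrDl sub0r -(ler0_norm r0) -abszE lez_nat -ltnS ltn_ord.
Qed.

Let step (m : nat) (a : history R N r) : history R N r :=
  \matrix_(i, j) if (j.+1 < (absz r).+1)%N then a i (inord j.+1)
    else c_ i m * a i (inord (absz r - tau)) + h i m a.

Let state (a : history R N r) := fix st (m : nat) : history R N r :=
  if m is m'.+1 then step m' (st m') else a.

Lemma solution_exists (a : history R N r) :
  exists2 x : int -> 'rV[R]_N, is_solution tau c_ h x & segment r x 0 = a.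
Proof.
pose x (t : int) : 'rV[R]_N := \row_i
  if t is Posz m then state a m i ord_max else a i (inord (absz (t - r))).
have tr : (tau <= absz r)%N.
  by rewrite -lez_nat abszE (ler0_norm r0) lerNr.
have Hx m : segment r x m = state a m.
  elim: m => [|m IH]; apply/matrixP => i j.
    rewrite !mxE add0r; case E: (r + j%:Z) => [n|n]; last first.
      by rewrite -E addrC addKr/= inord_val.
    have jr : (j <= absz r)%N by rewrite -ltnS.
    move: E; rewrite {1}rE => /eqP; rewrite addrC subr_eq -PoszD => /eqP[E].
    have n0 : n = 0%N.
      apply/eqP; rewrite -leqn0 -(leq_add2r (absz r)) add0n.
      by rewrite -E.
    by rewrite n0 /=; congr (a i _); apply/val_inj; rewrite /= E n0.
  have [jr|jr] := ltnP j.+1 (absz r).+1.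
    have := congr1 (fun M : history R N r => M i (inord j.+1)) IH.
    rewrite /= => E; rewrite [RHS]mxE jr -E; rewrite !mxE inordK//.
    by have -> : m.+1%:Z + (r + j%:Z) = m%:Z + (r + j.+1%:Z) by rewrite !intS; ring.
  have jE : (j : nat) = absz r by apply/eqP; rewrite eqn_leq -ltnS ltn_ord.
  rewrite mxE (_ : _ + _ = m.+1%:Z); last by rewrite jE {1}rE addNr addr0.
  rewrite /x mxE.
  by congr (state a m.+1 i _); apply/val_inj; rewrite /= jE.
exists x; last exact: Hx.
move=> m i; rewrite Hx -[1]/(1%:Z) -PoszD addn1 [LHS]mxE /= mxE ltnn.
congr (c_ i m * _ + _); rewrite -Hx mxE inordK ?ltnS ?leq_subr//.
by congr (x _ 0 i); rewrite {1}rE -subzn//; ring.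
Qed.

End WellPosed.

(* Main.v *)
Require Import Defs.
From HB Require Import structures.
From mathcomp Require Import all_boot all_order all_algebra.
From mathcomp Require Import zify ring.
From mathcomp Require Import all_classical all_reals all_analysis.
Import Order.TTheory GRing.Theory Num.Theory.
Import numFieldNormedType.Exports.

Set Implicit Arguments.
Unset Strict Implicit.
Unset Printing Implicit Defensive.

Local Open Scope ring_scope.

(** Write [p = tau + 1] and [q = c ^ (1 / p)].  The heart of the matter is that
    the difference [d] of any two solutions satisfies [|d t| <= A * q ^ t] for
    all [t >= r], where [A = |d_0| / (c * (1 - lambda))]
    ([solution_diff_decay]).  This is a strong induction on [t].  For [t <= 0]
    it holds because [q ^ t >= 1].  For [t > 0] write [t = n * p - s] with
    [s <= tau]: the delayed term links [x (k * p + p - s)] to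
    [x (k * p - s)], so along this residue class the equation is a first-order
    linear recurrence driven by [h].  Unrolling it
    ([linear_recurrence_le]) bounds [|d t|] by
<<
      c ^ n * |d (- s)| + sum_l (prod_k |c_i|) * H_i * |d_(l * p + tau - s)|
>>
    and the induction hypothesis bounds the segment norm in the sum by
    [A * q ^ (l * p + tau - s + r)].  Divided by [q ^ (n * p)], the sum is then
    at most [A] times the one that defines [lambda] ([rate_weight]), so the total
    is at most [q ^ (n * p) * (|d_0| + lambda * A) <= A * q ^ t].

    Since the oldest entry of the segment at time [m] sits at [m + r], segments
    contract like [q ^ (m + r)] ([solution_decay]); this is the stated estimate
    for any pair of solutions.  It remains to find one periodic solution
    ([periodic_solution_exists]).  For [k] large, the map that takes an initial
    segment to the segment at time [k * omega] is a contraction of a complete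
    space, hence has a fixed point [a].  Let [x] start at [a].  By periodicity
    of the coefficients [x (. + omega)] is a solution, and its initial segment
    is also fixed by the contraction, so it equals [a]; uniqueness of solutions
    then gives [x (t + omega) = x t]. *)

(** * The sup norm of matrices *)

Lemma mx_norm_le_entries (R : realType) (m n : nat) (M : 'M[R]_(m, n)) (e : R) :
  0 <= e -> (forall i j, `|M i j| <= e) -> `|M| <= e.
Proof.
move=> e0 Me; rewrite [leLHS]/Num.norm/= mx_normrE.
by apply: bigmax_le => // ij _; exact: Me.
Qed.

Lemma entry_le_mx_norm (R : realType) (m n : nat) (M : 'M[R]_(m, n)) i j :
  `|M i j| <= `|M|.
Proof.
rewrite [leRHS]/Num.norm/= mx_normrE.
exact: (le_bigmax 0 (fun ij : 'I_m * 'I_n => `|M ij.1 ij.2|) (i, j)).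
Qed.

(** Makes matrices a complete normed module: the two structures already exist on
    matrices, and this declares their join. *)
HB.instance Definition _ (R : realType) (m n : nat) :=
  Complete.on 'M[R]_(m, n).

Lemma banach_fixed_pointT (R : realType) (V : completeNormedModType R)
    (f : V -> V) (q : R) :
  0 <= q < 1 -> (forall a b, `|f a - f b| <= q * `|a - b|) ->
  exists a, f a = a.
Proof.
move=> /andP[q0 q1] fq.
have fT : {homo f : x / [set: V]%classic x >-> [set: V]%classic x} by [].
have [|||a _ fa] := @banach_fixed_point R V setT (mkfun_fun fT).
- exists (NngNum q0); split => //= -[a b] _ /=; exact: fq.
- exact: closedT.
- by exists 0.
by exists a; rewrite [in RHS]fa.
Qed.

(** * Linear recurrences and the exponential weight *)

(** Variation of constants, as an inequality: iterating the recurrence carries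
    each input [b l] through the coefficients of index larger than [l]. *)
Lemma linear_recurrence_le (R : realType) (u a b : nat -> R) :
  (forall k, 0 <= a k) -> (forall k, u k.+1 <= a k * u k + b k) ->
  forall n, u n <= (\prod_(0 <= k < n) a k) * u 0%N +
    \sum_(0 <= l < n) (\prod_(l.+1 <= k < n) a k) * b l.
Proof.
move=> a0 ub; elim=> [|n IH]; first by rewrite !big_geq// mul1r addr0.
apply: (le_trans (ub n)).
rewrite big_nat_recr//= big_nat_recr//=.
rewrite [\prod_(n.+1 <= _ < n.+1) _]big_geq// mul1r addrA.
rewrite lerD2r (le_trans (ler_wpM2l (a0 n) IH))// mulrDr mulrA.
rewrite [a n * \prod_(0 <= k < n) a k]mulrC lerD2l mulr_sumr.
rewrite le_eqVlt; apply/orP; left; apply/eqP.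
apply: eq_big_nat => l /andP[_ ln]; rewrite big_nat_recr//= mulrA.
by congr (_ * _); rewrite mulrC.
Qed.

Lemma powRD_gt0 (R : realType) (c s t : R) :
  0 < c -> c `^ (s + t) = c `^ s * c `^ t.
Proof. by move=> c0; rewrite powRD// (gt_eqF c0) implybT. Qed.

(** The exponential [q ^ t] with [q = c ^ (1 / p)], for integer times [t]
    of either sign. *)
Definition rate (R : realType) (c : R) (p : nat) (t : int) : R :=
  c `^ (t%:~R / p%:R).

Lemma rateD (R : realType) (c : R) (p : nat) (s t : int) :
  0 < c -> rate c p (s + t) = rate c p s * rate c p t.
Proof. by move=> c0; rewrite /rate intrD mulrDl powRD_gt0. Qed.

Lemma rate_gt0 (R : realType) (c : R) (p : nat) (t : int) :
  0 < c -> 0 < rate c p t.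
Proof. by move=> c0; rewrite powR_gt0. Qed.

Lemma rate_le (R : realType) (c : R) (p : nat) (s t : int) :
  0 < c <= 1 -> s <= t -> rate c p t <= rate c p s.
Proof.
by move=> c01 st; apply: ger_powR => //; rewrite ler_wpM2r ?invr_ge0// ler_int.
Qed.

Lemma rate_mul (R : realType) (c : R) (p n : nat) :
  0 <= c -> (0 < p)%N -> rate c p (n * p)%N%:Z = c ^+ n.
Proof.
move=> c0 p0; rewrite /rate -pmulrn natrM mulfK ?powR_mulrn//.
by rewrite pnatr_eq0 -lt0n.
Qed.

Lemma rate_nat (R : realType) (c : R) (p m : nat) :
  rate c p m%:Z = (c `^ (1 / p%:R)) ^+ m.
Proof. by rewrite -powR_mulrn ?powR_ge0// -powRrM mulrC mulrA mulr1. Qed.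

(** The power of [c] that weights the sums defining [lambda] is
    [q ^ (m + r - n * p)], where [p = tau + 1] and [m = l * p + (tau - s)] is
    the time of the [l]-th input: it compares the oldest entry of the segment
    at time [m] with time [n * p]. *)
Lemma rate_weight (R : realType) (c : R) (tau l s n : nat) (r : int) :
  0 < c -> (s <= tau)%N ->
  c `^ (l%:R + (r%:~R - s%:R - 1) / tau.+1%:R - n%:R + 1)
    * rate c tau.+1 (n * tau.+1)%N%:Z
  = rate c tau.+1 ((l * tau.+1 + (tau - s))%N%:Z + r).
Proof.
move=> c0 st; rewrite /rate -powRD_gt0//.
congr powR; rewrite intrD -!pmulrn natrD !natrM natrB// -natr1.
by field; rewrite natr1 pnatr_eq0.
Qed.

(** * The sums bounded by lambda *)

Lemma weighted_sum_ge0 (R : realType) (N : nat) (r : int) (tau : nat)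
    (c_ H : 'I_N -> nat -> R) (c : R) (i : 'I_N) (s : 'I_tau.+1) (n : nat) :
  (forall j m, 0 <= H j m) -> 0 <= weighted_sum r c_ H c i s n.
Proof.
move=> H0; apply: sumr_ge0 => l _; rewrite mulr_ge0 ?powR_ge0// mulr_ge0//.
by apply: prodr_ge0.
Qed.

Lemma weighted_sum_le_lambda (R : realType) (N : nat) (r : int) (tau : nat)
    (c_ H : 'I_N -> nat -> R) (c : R) (i : 'I_N) (s : 'I_tau.+1) (n : nat) :
  (0 < n)%N ->
  ((weighted_sum r c_ H c i s n)%:E <= lambda r tau c_ H c)%E.
Proof.
move=> n0; rewrite /lambda.
pose G j := \big[maxe/-oo%E]_(s < tau.+1)
    ereal_sup [set (weighted_sum r c_ H c j s n)%:E
              | n in [set n : nat | (0 < n)%N]]%classic.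
apply: (le_trans _ (le_bigmax -oo%E G i)).
pose F (s' : 'I_tau.+1) :=
    ereal_sup [set (weighted_sum r c_ H c i s' n)%:E
              | n in [set n : nat | (0 < n)%N]]%classic.
apply: (le_trans _ (le_bigmax -oo%E F s)).
by apply: ereal_sup_ubound; exists n.
Qed.

Lemma weighted_sum_le_fine_lambda (R : realType) (N : nat) (r : int) (tau : nat)
    (c_ H : 'I_N -> nat -> R) (c : R) (i : 'I_N) (s : 'I_tau.+1) (n : nat) :
  (lambda r tau c_ H c < +oo)%E -> (0 < n)%N ->
  weighted_sum r c_ H c i s n <= fine (lambda r tau c_ H c).
Proof.
move=> ly n0; have := weighted_sum_le_lambda r c_ H c i s n0.
by move: ly; case: (lambda _ _ _ _ _) => [l| |]//= _; rewrite lee_fin.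
Qed.

(** * Exponential decay of the difference of two solutions *)

Lemma segment_diff_le (R : realType) (N : nat) (r : int)
    (x y : int -> 'rV[R]_N) (m : nat) (e : R) : r <= 0 -> 0 <= e ->
  (forall (t : int) i, m%:Z + r <= t -> t <= m%:Z ->
     `|x t 0 i - y t 0 i| <= e) ->
  `|segment r x m - segment r y m| <= e.
Proof.
move=> r0 e0 xye; apply: mx_norm_le_entries => // i j; rewrite !mxE.
by apply: xye; have := ltn_ord j; lia.
Qed.

Lemma diff_le_segment (R : realType) (N : nat) (r : int)
    (x y : int -> 'rV[R]_N) (m : nat) (t : int) (i : 'I_N) :
  m%:Z + r <= t -> t <= m%:Z ->
  `|x t 0 i - y t 0 i| <= `|segment r x m - segment r y m|.
Proof.
move=> rt tm.
have jr : (absz (t - m%:Z - r)%R < (absz r).+1)%N by lia.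
have := entry_le_mx_norm (segment r x m - segment r y m) i (Ordinal jr).
rewrite !mxE /= (_ : m%:Z + (r + _) = t)//; lia.
Qed.

(** Strong induction on [t].  The equation expresses a value in terms of the one
    [tau + 1] steps earlier, so it is unrolled along the residue class of [t]
    modulo [tau + 1]; the inputs then involve segments at earlier times only,
    and the bound [L < 1] on the weighted sums closes the induction. *)
Lemma solution_diff_decay (R : realType) (N tau : nat) (r : int)
    (c_ : 'I_N -> nat -> R) (h : 'I_N -> nat -> history R N r -> R)
    (H : 'I_N -> nat -> R) (c L : R) (x y : int -> 'rV[R]_N) :
  r <= - tau%:Z ->
  (forall i m, 0 <= H i m) ->
  (forall i m a b, `|h i m a - h i m b| <= H i m * `|a - b|) ->
  0 < c < 1 ->
  (forall i m, `|c_ i m| <= c) ->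
  L < 1 ->
  (forall i (s : 'I_tau.+1) n, (0 < n)%N -> weighted_sum r c_ H c i s n <= L) ->
  is_solution tau c_ h x -> is_solution tau c_ h y ->
  forall (t : int) i, r <= t ->
    `|x t 0 i - y t 0 i| <=
      c^-1 / (1 - L) * `|segment r x 0 - segment r y 0| * rate c tau.+1 t.
Proof.
move=> r_tau H0 hH /andP[c0 c1] c_c L1 wL xs ys.
set D := `|segment r x 0 - _|; set A := c^-1 / (1 - L) * D.
have D0 : 0 <= D by rewrite normr_ge0.
have L1' : 0 < 1 - L by rewrite subr_gt0.
have A0 : 0 <= A by rewrite !mulr_ge0 ?invr_ge0 ?(ltW c0) ?(ltW L1').
have DA : D <= A * (1 - L).
  by rewrite /A mulrAC divfK ?gt_eqF// ler_peMl// invf_ge1 ?ltW.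
(* Opaque, so that [-!mulrA] below does not reassociate the factors of [A]. *)
clearbody A.
have c01 : 0 < c <= 1 by rewrite c0 ltW.
have r0 : r <= 0 by lia.
suff B (n : nat) (t : int) i : r <= t -> t <= n%:Z ->
    `|x t 0 i - y t 0 i| <= A * rate c tau.+1 t.
  by move=> t i rt; apply: (B (absz t)) => //; lia.
elim: n t i => [|n IH] t i rt tn.
  apply: (@le_trans _ _ D); first by apply: diff_le_segment; rewrite ?add0r.
  have L0 : 0 <= L.
    by apply: le_trans (wL i ord0 1%N isT); exact: weighted_sum_ge0.
  apply: (le_trans DA); apply: ler_wpM2l => //.
  apply: (@le_trans _ _ 1); first by rewrite gerBl.
  by rewrite -(powRr0 c) -(mul0r tau.+1%:R^-1) (@rate_le _ c tau.+1 t 0).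
have [tn'|nt] := leP t n%:Z; first exact: IH.
(* The time [t = n + 1] is the successor of [n = l0 * (tau + 1) + (tau - s)],
   which makes it [(l0 + 1) * (tau + 1) - s]. *)
have [s ts] : exists s : 'I_tau.+1, (tau - s = n %% tau.+1)%N.
  exists (inord (tau - n %% tau.+1)).
  by rewrite inordK ?subKn ?ltnS ?leq_subr// -ltnS ltn_mod.
have st : (s <= tau)%N by rewrite -ltnS.
pose l0 := (n %/ tau.+1)%N.
have tE : t = (l0.+1 * tau.+1)%N%:Z - s%:Z.
  have -> : t = n.+1%:Z by lia.
  by have := divn_eq n tau.+1; rewrite -/l0 -ts; have := ltn_ord s; nia.
pose time k := (k * tau.+1 + (tau - s))%N.
pose u k :=
  `|x ((k * tau.+1)%N%:Z - s%:Z) 0 i - y ((k * tau.+1)%N%:Z - s%:Z) 0 i|.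
pose b k := H i (time k) * `|segment r x (time k) - segment r y (time k)|.
have urec k : u k.+1 <= `|c_ i (time k)| * u k + b k.
  have e1 : (k.+1 * tau.+1)%N%:Z - s%:Z = (time k)%:Z + 1.
    by rewrite /time mulSn; move: (k * tau.+1)%N => kp; lia.
  have e2 : (k * tau.+1)%N%:Z - s%:Z = (time k)%:Z - tau%:Z.
    by rewrite /time; move: (k * tau.+1)%N => kp; lia.
  rewrite /u e1 e2 xs ys opprD addrACA -mulrBr.
  by apply: (le_trans (ler_normD _ _)); rewrite normrM lerD2l hH.
have := linear_recurrence_le (fun k => normr_ge0 (c_ i (time k))) urec l0.+1.
rewrite {1}/u -tE => /le_trans; apply.
(* Time [t] is [s] steps before [l0.+1 * tau.+1], so it is enough to prove the
   bound with the smaller rate at the latter. *)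
have rate_t : rate c tau.+1 (l0.+1 * tau.+1)%N%:Z <= rate c tau.+1 t.
  by apply: rate_le => //; rewrite tE; lia.
apply: le_trans (ler_wpM2l A0 rate_t).
set W := rate c tau.+1 _; have W0 : 0 <= W by rewrite ltW ?rate_gt0.
(* The share [1 - L] of the bound pays for the initial value, and the share [L]
   for the inputs. *)
rewrite (_ : A * W = W * (A * (1 - L)) + A * L * W); last by ring.
apply: lerD.
  apply: ler_pM => //.
  - by apply: prodr_ge0.
  - by rewrite /u normr_ge0.
  - rewrite /W rate_mul ?(ltW c0)//.
    rewrite -[X in c ^+ X]subn0 -prodr_const_nat.
    by apply: ler_prod => k _; rewrite normr_ge0 c_c.
  - apply: le_trans DA; apply: diff_le_segment; rewrite mul0n.
      by have := ltn_ord s; lia.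
    lia.
apply: (@le_trans _ _ (A * weighted_sum r c_ H c i s l0.+1 * W)); last first.
  by rewrite ler_wpM2r// ler_wpM2l// wL.
rewrite /weighted_sum mulr_sumr mulr_suml.
apply: ler_sum_nat => l /andP[_ ll]; rewrite -/(time l).
rewrite /b -!mulrA [leRHS]mulrCA ler_wpM2l ?prodr_ge0//.
rewrite [leRHS]mulrCA ler_wpM2l// rate_weight// -/(time l).
apply: segment_diff_le => //; first by rewrite mulr_ge0// ltW ?rate_gt0.
move=> t' j rt' t'l; have tl : (time l <= n)%N.
  by rewrite /time; have := divn_eq n tau.+1; rewrite -/l0 ts; nia.
apply: (@le_trans _ _ (A * rate c tau.+1 t')).
  by apply: IH; lia.
by rewrite ler_wpM2l// rate_le.
Qed.

(** The entries of the segment at time [m] have times at least [m + r], where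
    the exponential bound is the weakest; this costs the factor
    [c ^ (r / (tau + 1))]. *)
Lemma solution_decay (R : realType) (N tau : nat) (r : int)
    (c_ : 'I_N -> nat -> R) (h : 'I_N -> nat -> history R N r -> R)
    (H : 'I_N -> nat -> R) (c L : R) (x y : int -> 'rV[R]_N) (m : nat) :
  r <= - tau%:Z ->
  (forall i m, 0 <= H i m) ->
  (forall i m a b, `|h i m a - h i m b| <= H i m * `|a - b|) ->
  0 < c < 1 ->
  (forall i m, `|c_ i m| <= c) ->
  L < 1 ->
  (forall i (s : 'I_tau.+1) n, (0 < n)%N -> weighted_sum r c_ H c i s n <= L) ->
  is_solution tau c_ h x -> is_solution tau c_ h y ->
  `|segment r x m - segment r y m| <=
    c `^ (r%:~R / tau.+1%:R - 1) / (1 - L) * (c `^ (1 / tau.+1%:R)) ^+ m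
    * `|segment r x 0 - segment r y 0|.
Proof.
move=> r_tau H0 hH c01 c_c L1 wL xs ys; have /andP[c0 c1] := c01.
set D := `|segment r x 0 - _|.
have -> : c `^ (r%:~R / tau.+1%:R - 1) / (1 - L)
      * (c `^ (1 / tau.+1%:R)) ^+ m * D
    = c^-1 / (1 - L) * D * rate c tau.+1 (m%:Z + r).
  rewrite rateD// rate_nat powRD_gt0//.
  by rewrite powR_inv1 ?ltW// /rate; ring.
have A0 : 0 <= c^-1 / (1 - L) * D.
  by rewrite !mulr_ge0 ?invr_ge0 ?subr_ge0 ?(ltW c0) ?(ltW L1) ?normr_ge0.
apply: segment_diff_le => [||t i rt tm]; first lia.
  by rewrite mulr_ge0// ltW ?rate_gt0.
have rt' : r <= t by lia.
apply: (le_trans (solution_diff_decay r_tau H0 hH c01 c_c L1 wL xs ys i rt')).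
by rewrite ler_wpM2l// rate_le ?c0 ?(ltW c1).
Qed.

(** * The periodic solution *)

Lemma segment_shift (R : realType) (N : nat) (r : int) (x : int -> 'rV[R]_N)
    (k m : nat) :
  segment r (fun t => x (t + k%:Z)) m = segment r x (m + k).
Proof.
apply/matrixP => i j; rewrite !mxE PoszD; congr (x _ 0 i); lia.
Qed.

Lemma solution_shift (R : realType) (N tau : nat) (r : int)
    (c_ : 'I_N -> nat -> R) (h : 'I_N -> nat -> history R N r -> R)
    (x : int -> 'rV[R]_N) (k : nat) :
  (forall i m, c_ i (m + k)%N = c_ i m) ->
  (forall i m a, h i (m + k)%N a = h i m a) ->
  is_solution tau c_ h x -> is_solution tau c_ h (fun t => x (t + k%:Z)).
Proof.
move=> ck hk xs m i; rewrite segment_shift addrAC -PoszD xs ck hk PoszD.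
by rewrite addrAC.
Qed.

Lemma segment_unique (R : realType) (N tau : nat) (r : int)
    (c_ : 'I_N -> nat -> R) (h : 'I_N -> nat -> history R N r -> R)
    (x y : int -> 'rV[R]_N) (m : nat) :
  r <= - tau%:Z -> is_solution tau c_ h x -> is_solution tau c_ h y ->
  segment r x 0 = segment r y 0 -> segment r x m = segment r y m.
Proof.
move=> r_tau xs ys xy; apply/matrixP => i j; rewrite !mxE.
by rewrite (solution_unique r_tau xs ys xy)// addrCA lerDl.
Qed.

Lemma periodic_mul {T : Type} (f : nat -> T) (omega k : nat) :
  (forall m, f (m + omega)%N = f m) -> forall m, f (m + k * omega)%N = f m.
Proof.
by move=> fo; elim: k => [|k IH] m; rewrite ?addn0// mulSnr addnA fo IH.
Qed.

(** The map [Q] from an initial segment to the segment after [k] periods is a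
    contraction once [C * q ^ (k * omega) < 1].  Shifting by one period commutes
    with [Q], so it preserves the unique fixed point of [Q]. *)
Lemma periodic_solution_exists (R : realType) (N omega tau : nat) (r : int)
    (c_ : 'I_N -> nat -> R) (h : 'I_N -> nat -> history R N r -> R) (C q : R) :
  (0 < omega)%N -> r <= - tau%:Z ->
  (forall i m, c_ i (m + omega)%N = c_ i m) ->
  (forall i m a, h i (m + omega)%N a = h i m a) ->
  0 <= C -> 0 <= q < 1 ->
  (forall x y m, is_solution tau c_ h x -> is_solution tau c_ h y ->
    `|segment r x m - segment r y m| <=
      C * q ^+ m * `|segment r x 0 - segment r y 0|) ->
  exists2 x, is_solution tau c_ h x & is_periodic r omega x.
Proof.
move=> o0 r_tau cp hp C0 /andP[q0 q1] dec.
have [k Ck] : exists k : nat, C * q ^+ (k * omega)%N < 1.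
  have := @cvg_geometric R C q; rewrite ger0_norm// => /(_ q1).
  move=> /cvgrPdist_lt/(_ 1 ltr01)[k _ /(_ (k * omega)%N)] /=.
  rewrite sub0r normrN ger0_norm ?mulr_ge0 ?exprn_ge0// => ?.
  by exists k; auto using leq_pmulr.
have /boolp.choice[sol solP] (a : history R N r) :
    exists x, is_solution tau c_ h x /\ segment r x 0 = a.
  by have [x xs xa] := solution_exists c_ h r_tau a; exists x.
pose Q a := segment r (sol a) (k * omega).
have [//||a aQ] := @banach_fixed_pointT R 'M[R]_(N, (absz r).+1) Q
  (C * q ^+ (k * omega)).
- by rewrite Ck mulr_ge0 ?exprn_ge0.
- move=> a b; have [as_ aE] := solP a; have [bs bE] := solP b.
  by have := dec _ _ (k * omega)%N as_ bs; rewrite aE bE.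
have [xs xa] := solP a.
exists (sol a) => //.
set x := sol a in xs xa *.
pose y t := x (t + omega%:Z).
have ys : is_solution tau c_ h y by exact: solution_shift.
pose z t := x (t + (k * omega)%N%:Z).
have zs : is_solution tau c_ h z.
  apply: solution_shift => // i m.
    exact: (periodic_mul k (cp i)).
  by move=> b; exact: (periodic_mul k (fun m => hp i m b)).
have xQ : segment r x (k * omega) = segment r x 0 by rewrite [RHS]xa; exact: aQ.
(* After [k] periods the shifted solution [y] has reached the segment of [z] at
   time [omega], and [z] agrees with [x] because [a] is fixed by [Q]. *)
have yQ : segment r y (k * omega) = segment r y 0.
  rewrite !segment_shift add0n addnC -segment_shift.
  by apply: segment_unique zs xs _; rewrite // segment_shift add0n xa.
have y0 : segment r y 0 = segment r x 0.
  apply/eqP; rewrite -subr_eq0 -normr_le0 leNgt; apply/negP => d0.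
  have := dec _ _ (k * omega)%N ys xs; rewrite yQ xQ.
  by rewrite leNgt gtr_pMl// Ck.
by move=> t rt; exact: (solution_unique r_tau ys xs y0 rt).
Qed.

(** * Existence and global exponential stability *)

Theorem theorem2 (R : realType) (N omega tau : nat) (r : int)
    (c_ : 'I_N -> nat -> R) (h : 'I_N -> nat -> history R N r -> R)
    (H : 'I_N -> nat -> R) (c : R) :
  (0 < N)%N -> (0 < omega)%N -> r <= - tau%:Z ->
  (forall i m, -1 < c_ i m < 1) ->
  (forall i m, c_ i (m + omega)%N = c_ i m) ->
  (forall i m a, h i (m + omega)%N a = h i m a) ->
  (forall i m, 0 < H i m) ->
  (forall i m a b, `|h i m a - h i m b| <= H i m * `|a - b|) ->
  0 < c < 1 ->
  (forall i m, `|c_ i m| <= c) ->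
  (lambda r tau c_ H c < 1)%E ->
  exists xs : int -> 'rV[R]_N,
    [/\ is_solution tau c_ h xs,
        is_periodic r omega xs &
        forall (a : history R N r) (x : int -> 'rV[R]_N),
          is_solution tau c_ h x -> segment r x 0 = a ->
          forall m : nat, (0 < m)%N ->
            `|segment r x m - segment r xs m| <=
              c `^ (r%:~R / tau.+1%:R - 1) / (1 - fine (lambda r tau c_ H c))
              * (c `^ (1 / tau.+1%:R)) ^+ m * `|a - segment r xs 0|].
Proof.
move=> N0 o0 r_tau _ cp hp Hpos hH c01 c_c lam1.
have H0 i m : 0 <= H i m by exact: ltW.
have [c0 c1] := andP c01.
have lamy : (lambda r tau c_ H c < +oo)%E by exact: lt_trans lam1 (ltry 1).
pose L := fine (lambda r tau c_ H c).
have wL i (s : 'I_tau.+1) n : (0 < n)%N -> weighted_sum r c_ H c i s n <= L.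
  exact: weighted_sum_le_fine_lambda.
have L1 : L < 1.
  have := weighted_sum_le_lambda r c_ H c (Ordinal N0) (@ord0 tau) (ltn0Sn 0).
  by rewrite /L; move: lam1; case: (lambda _ _ _ _ _).
pose C := c `^ (r%:~R / tau.+1%:R - 1) / (1 - L).
have dec x y m : is_solution tau c_ h x -> is_solution tau c_ h y ->
    `|segment r x m - segment r y m| <=
      C * (c `^ (1 / tau.+1%:R)) ^+ m * `|segment r x 0 - segment r y 0|.
  exact: (@solution_decay R N tau r c_ h H c L).
have q01 : 0 <= c `^ (1 / tau.+1%:R) < 1.
  have : c `^ (1 / tau.+1%:R) < 1 `^ (1 / tau.+1%:R).
    by rewrite gt0_ltr_powR ?nnegrE ?(ltW c0) ?divr_gt0.
  by rewrite powR_ge0 powR1.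
have C0 : 0 <= C by rewrite mulr_ge0 ?powR_ge0 ?invr_ge0 ?subr_ge0 ?(ltW L1).
have [xs xss xsp] := periodic_solution_exists o0 r_tau cp hp C0 q01 dec.
by exists xs; split => // a x xsol <- m _; exact: dec.
Qed.
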